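(* Let $H$ be a complex Hilbert space and let $A$ be a $^*$-subalgebra of $B(H)$ (not assumed closed and not assumed unital). The following are equivalent. (1) $A$ is regular in the sense of von Neumann: for each $x\in A$ there exists $y\in A$ with $xyx=x$. (2) $A$ is algebraic: for each $x\in A$ the subalgebra of $B(H)$ generated by $x$ is finite-dimensional. (3) Each operator in $A$ has closed range. (4) Each operator in $A$ has finite spectrum (spectrum taken in $B(H)$). (5) Each self-adjoint operator in $A$ has closed range. (6) Each self-adjoint operator in $A$ has finite spectrum.
   Context: $B(H)$ denotes the algebra of bounded linear operators on $H$. Subalgebras are not assumed norm closed. *)

(* Defs.v *)
From HB Require Import structures.
From mathcomp Require Import all_boot all_order all_algebra.
From mathcomp Require Import complex.
From mathcomp Require Import boolp classical_sets cardinality reals.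

Set Implicit Arguments.
Unset Strict Implicit.
Unset Printing Implicit Defensive.

Import Order.TTheory GRing.Theory Num.Theory.
Local Open Scope ring_scope.
Local Open Scope classical_set_scope.

Section HilbertDefs.
Variable R : realType.
Variable V : lmodType R[i].
Variable ip : V -> V -> R[i].

Definition inner_product_axioms : Prop :=
  (forall (a : R[i]) (x y z : V), ip (a *: x + y) z = a * ip x z + ip y z) /\
  (forall x y : V, ip y x = conjc (ip x y)) /\
  (forall x : V, 0 <= ip x x) /\
  (forall x : V, ip x x = 0 -> x = 0).

Definition hnorm (x : V) : R := Num.sqrt (complex.Re (ip x x)).

Definition hcauchy (u : nat -> V) : Prop :=
  forall e : R, 0 < e -> exists N : nat, forall m n : nat,
    (N <= m)%N -> (N <= n)%N -> hnorm (u m - u n) < e.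

Definition hconverges (u : nat -> V) (y : V) : Prop :=
  forall e : R, 0 < e -> exists N : nat, forall n : nat,
    (N <= n)%N -> hnorm (u n - y) < e.

Definition hilbert_space : Prop :=
  inner_product_axioms /\
  (forall u : nat -> V, hcauchy u -> exists y : V, hconverges u y).

Definition bounded_op (T : V -> V) : Prop :=
  (forall (a : R[i]) (x y : V), T (a *: x + y) = a *: T x + T y) /\
  (exists M : R, forall x : V, hnorm (T x) <= M * hnorm x).

Definition is_adjoint (T S : V -> V) : Prop :=
  forall x y : V, ip (T x) y = ip x (S y).

Definition self_adjoint (T : V -> V) : Prop := is_adjoint T T.

Definition star_subalgebra (A : set (V -> V)) : Prop :=
  (A `<=` bounded_op) /\
  A (fun _ => 0) /\
  (forall S T, A S -> A T -> A (fun x => S x + T x)) /\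
  (forall (a : R[i]) T, A T -> A (fun x => a *: T x)) /\
  (forall S T, A S -> A T -> A (S \o T)) /\
  (forall T, A T -> exists2 S, A S & is_adjoint T S).

Definition hclosed (S : set V) : Prop :=
  forall y : V, ~ S y ->
    exists2 e : R, 0 < e & forall z : V, hnorm (z - y) < e -> ~ S z.

Definition closed_range (T : V -> V) : Prop := hclosed (range T).

Definition invertible_op (T : V -> V) : Prop :=
  exists2 S : V -> V, bounded_op S & (S \o T = id /\ T \o S = id).

Definition spectrum (T : V -> V) : set R[i] :=
  [set l : R[i] | ~ invertible_op (fun x => T x - l *: x)].

Definition op_span (n : nat) (b : 'I_n -> V -> V) : set (V -> V) :=
  [set S | exists c : 'I_n -> R[i],
           S = (fun x => \sum_(i < n) c i *: b i x)].

(* the (non-unital) subalgebra of B(H) generated by T: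
   all polynomials in T without constant term *)
Definition gen_subalgebra (T : V -> V) : set (V -> V) :=
  [set S | exists (n : nat) (c : 'I_n -> R[i]),
           S = (fun x => \sum_(i < n) c i *: iter i.+1 T x)].

Definition finite_dim (W : set (V -> V)) : Prop :=
  exists (n : nat) (b : 'I_n -> V -> V),
    (forall i, W (b i)) /\ W `<=` op_span b.

End HilbertDefs.

(* Main.v *)
(** All conditions are compared with the algebraicity of the self-adjoint
    elements of A.

    - If a self-adjoint S has closed range, a gliding hump argument yields c > 0
      with c |S v| <= |S (S v)|, so that no approximate eigenvalue of S lies in
      0 < |h| < c. For T self-adjoint in A and x0 real, apply this to
      S = T (T - x0): the approximate eigenvalues of T can only accumulate at 0
      and x0, with x0 isolated, so by boundedness they are finitely many.
    - If T is self-adjoint with finite approximate spectrum, let p be real and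
      vanish on it. If p(T) <> 0, then |p(T)|^2 is an approximate eigenvalue of
      p(T)^2, and factoring p^2 - |p(T)|^2 gives an approximate eigenvalue of T
      at which p does not vanish. Hence p(T) = 0.
    - If a = x^* x is algebraic, then a = a q(a) a for some polynomial q, and
      y = q(a) a q(a) x^* satisfies x y x = x.
    - For x = a + i b in A, all a + t b with t real are algebraic, hence of the
      same degree for infinitely many t. Being algebraic of given degree is
      expressed by the vanishing of determinants polynomial in t, so the case
      t = i follows and x is algebraic. *)

Require Import Defs.
From HB Require Import structures.
From mathcomp Require Import all_boot all_order all_algebra.
From mathcomp Require Import complex.
From mathcomp Require Import boolp classical_sets cardinality reals.
From mathcomp Require Import ereal measure lebesgue_measure.
From mathcomp Require Import ring lra.
Import Order.TTheory GRing.Theory Num.Theory.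
Local Open Scope ring_scope.
Local Open Scope classical_set_scope.

Set Implicit Arguments.
Unset Strict Implicit.
Unset Printing Implicit Defensive.

(** * Polynomials in a linear operator *)

Section OperatorPolynomials.
Variables (K : fieldType) (V : lmodType K).
Implicit Types (T : V -> V) (p q : {poly K}).

Lemma linear_op0 T : linear T -> T 0 = 0.
Proof.
move=> Tlin; have := Tlin 1 0 0; rewrite !scale1r addr0.
by move=> /(congr1 (fun u => u - T 0)); rewrite addrK subrr.
Qed.

Lemma linear_opZ T (Tlin : linear T) a v : T (a *: v) = a *: T v.
Proof. by rewrite -[a *: v]addr0 Tlin linear_op0// addr0. Qed.

Lemma linear_opD T (Tlin : linear T) u v : T (u + v) = T u + T v.
Proof. by rewrite -[u]scale1r Tlin !scale1r. Qed.

Lemma linear_opN T (Tlin : linear T) v : T (- v) = - T v.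
Proof. by rewrite -!scaleN1r linear_opZ. Qed.

Lemma linear_opB T (Tlin : linear T) u v : T (u - v) = T u - T v.
Proof. by rewrite linear_opD// linear_opN. Qed.

(** The operator p(T), for T a bare function; linearity is a separate hypothesis of laws such as
    [pevM]. *)
Definition pev p T : V -> V := fun v => \sum_(i < size p) p`_i *: iter i T v.

Lemma pev_wide n p T v :
  (size p <= n)%N -> pev p T v = \sum_(i < n) p`_i *: iter i T v.
Proof.
move=> pn; rewrite /pev (big_ord_widen n (fun i => p`_i *: iter i T v))//.
rewrite big_mkcond; apply: eq_bigr => i _.
by case: ltnP => // /leq_sizeP ->//; rewrite scale0r.
Qed.

Lemma pev0 T v : pev 0 T v = 0.
Proof. by rewrite /pev size_poly0 big_ord0. Qed.

Lemma pevC c T v : pev c%:P T v = c *: v.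
Proof. by rewrite (@pev_wide 1) ?size_polyC_leq1// big_ord1 coefC. Qed.

Lemma pev1 T v : pev 1 T v = v.
Proof. by rewrite pevC scale1r. Qed.

Lemma pevD p q T v : pev (p + q) T v = pev p T v + pev q T v.
Proof.
pose n := maxn (size p) (size q).
rewrite !(@pev_wide n) ?leq_maxl ?leq_maxr ?size_polyD// -big_split.
by apply: eq_bigr => i _; rewrite coefD scalerDl.
Qed.

Lemma pevZ c p T v : pev (c *: p) T v = c *: pev p T v.
Proof.
rewrite !(@pev_wide (size p)) ?size_scale_leq// scaler_sumr.
by apply: eq_bigr => i _; rewrite coefZ scalerA.
Qed.

Lemma pevB p q T v : pev (p - q) T v = pev p T v - pev q T v.
Proof. by rewrite pevD -[- q]scaleN1r pevZ scaleN1r. Qed.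

Lemma pevMX p T v : pev (p * 'X) T v = pev p T (T v).
Proof.
rewrite (@pev_wide (size p).+1); last first.
  by rewrite (leq_trans (size_polyMleq _ _))// size_polyX addn2.
rewrite big_ord_recl coefMX/= scale0r add0r; apply: eq_bigr => i _.
by rewrite coefMX/= -iterSr.
Qed.

Lemma pevXC c T v : pev ('X - c%:P) T v = T v - c *: v.
Proof. by rewrite pevB pevC -['X]mul1r pevMX pev1. Qed.

Lemma pev_linear p T : linear T -> linear (pev p T).
Proof.
move=> Tlin; elim/poly_ind: p => [|p c IH] a u v.
  by rewrite !pev0 scaler0 addr0.
rewrite !pevD !pevMX !pevC Tlin IH !scalerDr !scalerA mulrC.
by rewrite !addrA; congr (_ + _); rewrite -!addrA; congr (_ + _); rewrite addrC.
Qed.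

Lemma pevM p q T v : linear T -> pev (p * q) T v = pev p T (pev q T v).
Proof.
move=> Tlin; have pl := pev_linear.
elim/poly_ind: q v => [|q c IH] v.
  by rewrite mulr0 !pev0 linear_op0//; exact: pl.
rewrite mulrDr mulrA pevD pevMX IH (mulrC p) mul_polyC pevZ.
rewrite pevD pevMX pevC (linear_opD (pl _ _ Tlin)).
by rewrite (linear_opZ (pl _ _ Tlin)).
Qed.

Lemma pev_comm T (Tlin : linear T) p v : T (pev p T v) = pev p T (T v).
Proof.
have E u : T u = pev 'X T u by rewrite -['X]mul1r pevMX pev1.
by rewrite !E -!pevM// mulrC.
Qed.

Lemma pevXn n T v : linear T -> pev 'X^n T v = iter n T v.
Proof.
move=> Tlin; elim: n v => [|n IH] v; first by rewrite expr0 pev1.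
by rewrite exprSr pevMX IH -iterSr.
Qed.

Definition algebraic_op T := exists2 p, p != 0 & forall v, pev p T v = 0.

(** Division with remainder by an annihilating q: only (p mod q) 'X survives on T, so n = size q
    powers suffice. *)
Lemma algebraic_gen_span T : linear T -> algebraic_op T ->
  exists n, forall p, exists c : 'I_n -> K,
    forall v, pev (p * 'X) T v = \sum_(i < n) c i *: iter i.+1 T v.
Proof.
move=> Tlin [q q0 qT]; exists (size q) => p.
exists (fun i => (p %% q)`_i) => v.
have -> : p * 'X = (p %/ q) * 'X * q + (p %% q) * 'X.
  by rewrite {1}(divp_eq p q); ring.
rewrite pevD pevM// qT linear_op0 ?add0r; last exact: pev_linear.
rewrite pevMX (@pev_wide (size q)); last by rewrite ltnW// ltn_modp.
by apply: eq_bigr => i _; rewrite -iterSr.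
Qed.

End OperatorPolynomials.

(** * Determinantal criterion for dependence, and operator pencils *)

Section DependentFamilies.
Variable K : fieldType.

(* If the maximal minors of the first family vanish one recurses; otherwise the
   expansion along the row of a free point x is the required relation. *)
Lemma dependent_of_det (X : Type) n (f : 'I_n -> X -> K) :
  (forall x : 'I_n -> X, \det (\matrix_(k, j) f j (x k)) = 0) ->
  exists2 c : 'I_n -> K, exists j, c j != 0 &
    forall x, \sum_j c j * f j x = 0.
Proof.
elim: n f => [|n IH] f detf.
  have x0 : 'I_0 -> X by case.
  by move: (detf x0) => /eqP; rewrite det_mx00 oner_eq0.
have [detg|] := pselect
    (forall y : 'I_n -> X, \det (\matrix_(k, j) f (lift ord0 j) (y k)) = 0).
  have [c [j cj] cf] := IH (fun j => f (lift ord0 j)) detg.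
  exists (fun i => if unlift ord0 i is Some i' then c i' else 0).
    by exists (lift ord0 j); rewrite liftK.
  move=> x; rewrite big_ord_recl unlift_none mul0r add0r -[RHS](cf x).
  by apply: eq_bigr => i _; rewrite liftK.
move=> /existsNP[y /eqP yn0].
exists (fun j : 'I_n.+1 => (-1) ^+ j * \det (\matrix_(k, i) f (lift j i) (y k))).
  by exists ord0; rewrite expr0 mul1r.
move=> x.
rewrite -[RHS](detf (fun k => if unlift ord0 k is Some i then y i else x)).
rewrite (expand_det_row _ ord0); apply: eq_bigr => j _.
rewrite !mxE unlift_none mulrC /cofactor add0n; congr (_ * (_ * \det _)).
by apply/matrixP => k i; rewrite !mxE liftK.
Qed.

Lemma finite_set_roots (p : {poly K}) : p != 0 -> finite_set [set x | root p x].
Proof.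
move=> p0; apply: contrapT => /(@infinite_set_fset _ _ (size p))[B BE szB].
have := @max_poly_roots _ p (finmap.enum_fset B) p0.
rewrite ltnNge szB; suff -> : all (root p) (finmap.enum_fset B).
  by move=> /(_ isT)/(_ (finmap.fset_uniq B)).
by apply/allP => x xB; exact: BE.
Qed.

Variable V : lmodType K.
Variable phi : V -> V -> K.
Hypothesis phi_lin : forall a u v w, phi (a *: u + v) w = a * phi u w + phi v w.
Hypothesis phi_def : forall u, phi u u = 0 -> u = 0.

Lemma form0 w : phi 0 w = 0.
Proof.
have := phi_lin 1 0 0 w; rewrite scale1r addr0 mul1r.
by move=> /(congr1 (fun x => x - phi 0 w)); rewrite addrK subrr.
Qed.

Lemma form_sum n (c : 'I_n -> K) (u : 'I_n -> V) w :
  phi (\sum_i c i *: u i) w = \sum_i c i * phi (u i) w.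
Proof.
by elim/big_rec2: _ => [|i x y _ <-]; [exact: form0|exact: phi_lin].
Qed.

Variables a b : V -> V.
Hypotheses (alin : linear a) (blin : linear b).
Let pencil t : V -> V := fun v => a v + t *: b v.

Lemma pencil_linear t : linear (pencil t).
Proof.
move=> c u v; rewrite /pencil alin blin !scalerDr !scalerA (mulrC t).
by rewrite !addrA; congr (_ + _); rewrite -!addrA; congr (_ + _); rewrite addrC.
Qed.

Lemma iter_pencil_linear t n : linear (iter n (pencil t)).
Proof. by elim: n => [|n IH] c u v //=; rewrite IH pencil_linear. Qed.

(** Peeling off the innermost factor: (a + t b)^(n+1) v = (a + t b)^n (a v) + t (a + t b)^n (b v).
    One P serves all t. *)
Lemma pencil_poly n v w :
  exists P : {poly K}, forall t, phi (iter n (pencil t) v) w = P.[t].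
Proof.
elim: n v => [|n IH] v; first by exists (phi v w)%:P => t; rewrite hornerC.
have [[P PE] [Q QE]] := (IH (a v), IH (b v)).
exists (Q * 'X + P) => t; rewrite iterSr {2}/pencil addrC.
by rewrite iter_pencil_linear phi_lin PE QE hornerD hornerMX mulrC.
Qed.

(* For fixed test vectors the Gram-like determinant of the powers of the pencil
   is a polynomial in t, so vanishing on an infinite set it vanishes everywhere. *)
Lemma algebraic_pencil d (E : set K) t : infinite_set E ->
  (forall s, E s -> exists2 p : {poly K}, p != 0 /\ (size p <= d)%N &
     forall v, pev p (pencil s) v = 0) ->
  algebraic_op (pencil t).
Proof.
move=> Einf Ealg.
have [x|P PE] := @choice (nat * (V * V)) {poly K}
    (fun x p => forall t, phi (iter x.1 (pencil t) x.2.1) x.2.2 = p.[t]).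
  exact: pencil_poly.
have detE (x : 'I_d -> V * V) s :
    \det (\matrix_(k < d, j < d) phi (iter j (pencil s) (x k).1) (x k).2) =
    (\det (\matrix_(k < d, j < d) P (nat_of_ord j, x k))).[s].
  rewrite -horner_evalE -det_map_mx; congr (\det _).
  by apply/matrixP => k j; rewrite !mxE (PE (nat_of_ord j, x k)).
have [x|c [j cj] cP] := @dependent_of_det (V * V) d
    (fun j vw => phi (iter j (pencil t) vw.1) vw.2).
  rewrite detE; suff -> : \det (\matrix_(k, j) P (nat_of_ord j, x k)) = 0.
    by rewrite horner0.
  apply: contrapT => /eqP/finite_set_roots fr; apply: Einf.
  (* For s in E the coefficients of an annihilating polynomial form a kernel vector; transposing
     lets it act from the left, as a row. *)
  apply: sub_finite_set fr => s Es /=; rewrite /root -detE -det_tr; apply/det0P.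
  have [p [p0 pd] ps] := Ealg s Es.
  exists (poly_rV p).
    by apply: contraNneq p0 => p0; rewrite -(poly_rV_K pd) p0 linear0.
  apply/rowP => k; rewrite !mxE.
  transitivity (phi (pev p (pencil s) (x k).1) (x k).2).
    rewrite (pev_wide _ _ pd) form_sum; apply: eq_bigr => i _.
    by rewrite !mxE.
  by rewrite ps form0.
exists (rVpoly (\row_i c i)).
  apply: contraNneq cj => /(congr1 (fun q : {poly K} => q`_j)).
  by rewrite coef_rVpoly_ord mxE coef0 => ->.
(* The relation holds for all test pairs; with p(a + t b) v itself as second vector, definiteness
   gives p(a + t b) v = 0. *)
move=> v; apply: phi_def; rewrite (@pev_wide _ _ d) ?size_poly// form_sum.
rewrite -[RHS](cP (v, pev (rVpoly (\row_i c i)) (pencil t) v)).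
by apply: eq_bigr => i _; rewrite coef_rVpoly_ord mxE (@pev_wide _ _ d) ?size_poly.
Qed.

End DependentFamilies.

(** * Inner product, norm and bounded operators *)

Section InnerProduct.
Variables (R : realType) (V : lmodType R[i]) (ip : V -> V -> R[i]).
Hypothesis ipP : inner_product_axioms ip.
Implicit Types (S T : V -> V) (u v w x y z : V) (p : {poly R[i]}).
Local Notation norm := (hnorm ip).
Local Notation realc := (real_complex R).

Definition re_ip x y : R := complex.Re (ip x y).
Local Notation rip := re_ip.

Lemma ip_lin a x y z : ip (a *: x + y) z = a * ip x z + ip y z.
Proof. by case: ipP => + _; apply. Qed.

Lemma ip_conj x y : ip y x = conjc (ip x y).
Proof. by case: ipP => _ [+ _]; apply. Qed.

Lemma ip_def x : ip x x = 0 -> x = 0.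
Proof. by case: ipP => _ [_ [_ +]]; apply. Qed.

Lemma ipZl a x y : ip (a *: x) y = a * ip x y.
Proof. by rewrite -[a *: x]addr0 ip_lin (form0 ip_lin) addr0. Qed.

Lemma ipDl x y z : ip (x + y) z = ip x z + ip y z.
Proof. by rewrite -[x]scale1r ip_lin mul1r scale1r. Qed.

Lemma ripC x y : rip x y = rip y x.
Proof. by rewrite /re_ip (ip_conj x); case: (ip x y). Qed.

Lemma ripDl x y z : rip (x + y) z = rip x z + rip y z.
Proof. by rewrite /re_ip ipDl; case: (ip x z) (ip y z) => ? ? []. Qed.

Lemma ripDr x y z : rip z (x + y) = rip z x + rip z y.
Proof. by rewrite ripC ripDl !(ripC z). Qed.

Lemma ripZl (r : R) x y : rip (realc r *: x) y = r * rip x y.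
Proof. by rewrite /re_ip ipZl; case: (ip x y) => a b /=; rewrite mul0r subr0. Qed.

Lemma ripZr (r : R) x y : rip x (realc r *: y) = r * rip x y.
Proof. by rewrite ripC ripZl ripC. Qed.

Lemma ripNl x y : rip (- x) y = - rip x y.
Proof.
have -> : - x = realc (-1) *: x by rewrite rmorphN1 scaleN1r.
by rewrite ripZl mulN1r.
Qed.

Lemma ripNr x y : rip x (- y) = - rip x y.
Proof. by rewrite ripC ripNl ripC. Qed.

Lemma rip_ge0 x : 0 <= rip x x.
Proof.
have : 0 <= ip x x by case: ipP => _ [_ [+ _]]; apply.
by rewrite /re_ip lecE => /andP[].
Qed.

Lemma ip_rip x : ip x x = realc (rip x x).
Proof.
rewrite /re_ip; have := ip_conj x x; case: (ip x x) => a b [] /eqP.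
by rewrite -subr_eq0 opprK -mulr2n mulrn_eq0 => /eqP ->.
Qed.

Lemma hnorm_ge0 x : 0 <= norm x. Proof. exact: sqrtr_ge0. Qed.

Lemma hnorm_sqr x : norm x ^+ 2 = rip x x.
Proof. exact: sqr_sqrtr (rip_ge0 x). Qed.

Lemma hnorm0_eq0 x : norm x = 0 -> x = 0.
Proof.
by move=> x0; apply: ip_def; rewrite ip_rip -hnorm_sqr x0 expr0n.
Qed.

Lemma hnormZ a x : norm (a *: x) = complex.Re `|a| * norm x.
Proof.
rewrite normc_def /= -sqrtrM ?addr_ge0 ?sqr_ge0//; congr Num.sqrt.
rewrite ipZl ip_conj ipZl ip_rip.
by case: a => a b /=; ring.
Qed.

Lemma hnormZr (r : R) x : norm (realc r *: x) = `|r| * norm x.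
Proof. by rewrite hnormZ normc_def/= expr0n addr0 sqrtr_sqr. Qed.

Lemma hnormN x : norm (- x) = norm x.
Proof.
have -> : - x = realc (-1) *: x by rewrite rmorphN1 scaleN1r.
by rewrite hnormZr normrN1 mul1r.
Qed.

Lemma hnorm_distC x y : norm (x - y) = norm (y - x).
Proof. by rewrite -hnormN opprB. Qed.

Lemma hnorm0 : norm 0 = 0.
Proof. by rewrite -[X in norm X](scale0r (0 : V)) (hnormZr 0) normr0 mul0r. Qed.

Lemma cauchy_schwarz x y : `|rip x y| <= norm x * norm y.
Proof.
have [y0|y0] := eqVneq (norm y) 0.
  by rewrite (hnorm0_eq0 y0) hnorm0 mulr0 ripC -(scale0r (0 : V)) (ripZl 0) mul0r normr0.
(* With r = [rip x y], the squared norm of |y|^2 x - r y is |y|^2 (|x|^2 |y|^2 - r^2). *)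
have := rip_ge0 (realc (rip y y) *: x - realc (rip x y) *: y).
rewrite ripDl !ripDr !ripNl !ripNr !ripZl !ripZr (ripC y x) -!hnorm_sqr => H.
have Y : 0 < norm y by rewrite lt_neqAle eq_sym y0 hnorm_ge0.
rewrite -ler_sqr ?nnegrE ?mulr_ge0 ?hnorm_ge0// real_normK ?num_real// exprMn.
rewrite -subr_ge0 -(pmulr_rge0 _ (exprn_gt0 2 Y)).
by apply: le_trans H _; rewrite le_eqVlt; apply/orP; left; apply/eqP; ring.
Qed.

Lemma ler_hnormD x y : norm (x + y) <= norm x + norm y.
Proof.
rewrite -ler_sqr ?nnegrE ?addr_ge0 ?hnorm_ge0// hnorm_sqr ripDl !ripDr (ripC y x).
have := le_trans (ler_norm _) (cauchy_schwarz x y).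
by rewrite -!hnorm_sqr; lra.
Qed.

Lemma ler_hnorm_dist x y z : norm (x - z) <= norm (x - y) + norm (y - z).
Proof. by apply: le_trans (ler_hnormD _ _); rewrite addrA subrK. Qed.

Lemma ler_hnormBr x y : norm x - norm y <= norm (x - y).
Proof. by rewrite lerBlDr (le_trans _ (ler_hnormD _ _))// subrK. Qed.

Lemma adjoint_rip S T x y : is_adjoint ip T S -> rip (T x) y = rip x (S y).
Proof. by rewrite /re_ip => ->. Qed.

Lemma bounded_linear T : bounded_op ip T -> linear T.
Proof. by case. Qed.

Lemma bounded_bound T : bounded_op ip T ->
  exists2 M : R, 0 < M & forall x, norm (T x) <= M * norm x.
Proof.
move=> [_ [M TM]]; exists (`|M| + 1); first by rewrite ltr_wpDl.
move=> x; apply: le_trans (TM x) _; rewrite ler_wpM2r ?hnorm_ge0//.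
by rewrite (le_trans (ler_norm _))// lerDl.
Qed.

Lemma bounded_id : bounded_op ip id.
Proof. by split=> //; exists 1 => x; rewrite mul1r. Qed.

Lemma bounded_comp S T : bounded_op ip S -> bounded_op ip T ->
  bounded_op ip (S \o T).
Proof.
move=> Sb Tb; split=> [a x y|]; first by rewrite /= (Tb.1) (Sb.1).
have [[M M0 SM] [N N0 TN]] := (bounded_bound Sb, bounded_bound Tb).
exists (M * N) => x /=; apply: le_trans (SM _) _.
by rewrite -mulrA ler_wpM2l// ltW.
Qed.

Lemma bounded_add S T : bounded_op ip S -> bounded_op ip T ->
  bounded_op ip (fun x => S x + T x).
Proof.
move=> [Slin [M SM]] [Tlin [N TN]]; split=> [a x y|].
  by rewrite Slin Tlin scalerDr addrACA.
by exists (M + N) => x; rewrite mulrDl (le_trans (ler_hnormD _ _))// lerD.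
Qed.

Lemma bounded_scale a T : bounded_op ip T -> bounded_op ip (fun x => a *: T x).
Proof.
move=> [Tlin [M TM]]; split=> [b x y|].
  by rewrite Tlin scalerDr !scalerA mulrC.
exists (complex.Re `|a| * M) => x; rewrite hnormZ -mulrA ler_wpM2l//.
by rewrite normc_def sqrtr_ge0.
Qed.

Lemma bounded_pev p T : bounded_op ip T -> bounded_op ip (pev p T).
Proof.
move=> Tb; elim/poly_ind: p => [|p c IH].
  suff -> : pev 0 T = (fun x => 0 *: x) by exact: bounded_scale bounded_id.
  by apply/funext => x; rewrite pev0 scale0r.
suff -> : pev (p * 'X + c%:P) T = (fun x => (pev p T \o T) x + c *: x).
  by apply: bounded_add; [exact: bounded_comp|exact: bounded_scale bounded_id].
by apply/funext => x; rewrite pevD pevMX pevC.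
Qed.

Lemma adjoint_pev S T p : linear T -> linear S -> is_adjoint ip T S ->
  is_adjoint ip (pev p T) (pev (map_poly conjc p) S).
Proof.
move=> Tlin Slin TS; elim/poly_ind: p => [|p c IH] x y.
  rewrite rmorph0 !pev0 (form0 ip_lin) ip_conj (form0 ip_lin).
  by rewrite rmorph0.
rewrite rmorphD rmorphM/= map_polyX map_polyC/= !pevD !pevMX !pevC.
rewrite ipDl ipZl IH TS (pev_comm Slin) [in RHS]ip_conj ipDl ipZl rmorphD rmorphM/=.
by rewrite conjcK -!ip_conj.
Qed.

End InnerProduct.

(** * Closed range of a self-adjoint operator and spectral gap at 0 *)

Section ClosedRange.
Variables (R : realType) (V : lmodType R[i]) (ip : V -> V -> R[i]).
Hypothesis HV : hilbert_space ip.
Let ipP : inner_product_axioms ip := HV.1.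
Local Notation norm := (hnorm ip).
Local Notation rip := (re_ip ip).
Local Notation realc := (real_complex R).
Variable T : V -> V.
Hypotheses (Tb : bounded_op ip T) (Tsa : self_adjoint ip T).
Let Tlin : linear T := Tb.1.

(* One step of a gliding hump: the inner product with v is large, relatively to
   |T v|, at every point near z'. *)
Lemma gliding_step (k : nat) (z : V) (e : R) :
  (forall c : R, 0 < c -> exists v, norm (T (T v)) < c * norm (T v)) ->
  range T z -> 0 < e -> exists z' e',
  [/\ range T z', [/\ 0 < e', e' <= e / 2 & e' <= k.+1%:R^-1],
      norm (z' - z) <= e &
      exists2 v, 0 < norm (T v) &
        forall y, norm (y - z') <= 2 * e' -> k%:R * norm (T v) <= `|rip y v|].
Proof.
move=> nogap [w _ wz] e0.
have k0 : 0 < k.+1%:R :> R by rewrite ltr0n.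
have [v vlt] := nogap _ (divr_gt0 e0 k0).
have TTv : rip (T (T v)) v = norm (T v) ^+ 2.
  by rewrite (hnorm_sqr ipP) (adjoint_rip _ _ Tsa).
have Tv0 : 0 < norm (T v).
  rewrite lt_neqAle eq_sym hnorm_ge0// andbT; apply: contraTneq vlt => ->.
  by rewrite mulr0 -leNgt hnorm_ge0.
set n := norm (T (T v)) in vlt.
have n0 : 0 < n.
  rewrite lt_neqAle eq_sym hnorm_ge0 andbT; apply/eqP => n0.
  have := cauchy_schwarz ipP (T (T v)) v.
  by rewrite -/n n0 mul0r TTv normr_le0 expf_eq0/= gt_eqF.
(* The sign s makes the displacement reinforce [rip z v] instead of cancelling it. *)
have [s s1 sz] : exists2 s : R, `|s| = 1 & 0 <= s * rip z v.
  have [h|h] := lerP 0 (rip z v); first by exists 1; rewrite ?normr1 ?mul1r.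
  by exists (-1); rewrite ?normrN1 ?mulN1r ?oppr_ge0 ?ltW.
(* The displacement d T T v has norm e and changes the inner product with v by e |T v|^2 / n in
   absolute value, more than (k + 1) |T v| by the choice of v. *)
pose d := s * (e / n).
have D0 : 0 < 2 * (norm v + 1) by rewrite mulr_gt0// ltr_wpDl ?hnorm_ge0.
exists (z + realc d *: T (T v)).
(* Besides halving and tending to 0, e' satisfies 2 e' |v| <= |T v|: moving by 2 e' costs at most
   one |T v|, hence k + 1 becomes k. *)
exists (Num.min (e / 2) (Num.min k.+1%:R^-1 (norm (T v) / (2 * (norm v + 1))))).
set e' := Num.min _ _.
have e'0 : 0 < e' by rewrite /e' !lt_min invr_gt0 k0 !divr_gt0.
split.
- exists (w + realc d *: T v) => //.
  by rewrite linear_opD// linear_opZ// wz.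
- by split=> //; rewrite /e' !ge_min lexx ?orbT.
- rewrite addrC addKr hnormZr// -/n normrM s1 mul1r.
  by rewrite (ger0_norm (ltW (divr_gt0 e0 n0))) divfK ?gt_eqF.
exists v => // y yz'.
have -> : rip y v = rip (y - (z + realc d *: T (T v))) v +
                    (rip z v + d * norm (T v) ^+ 2).
  by rewrite -TTv -ripZl// -!ripDl// subrK.
have big : k.+1%:R * norm (T v) <= `|rip z v + d * norm (T v) ^+ 2|.
  have s2 : s * s = 1 by rewrite -expr2 -(real_normK (num_real s)) s1 expr1n.
  suff h : k.+1%:R * norm (T v) <= s * (rip z v + d * norm (T v) ^+ 2).
    by rewrite (le_trans h)// (le_trans (ler_norm _))// normrM s1 mul1r.
  rewrite mulrDr ler_wpDl// /d !mulrA s2 mul1r ler_wpM2r ?hnorm_ge0//.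
  rewrite mulrAC ler_pdivlMr// mulrC; move: vlt.
  by rewrite mulrAC ltr_pdivlMr// mulrC => /ltW.
have small : `|rip (y - (z + realc d *: T (T v))) v| <= norm (T v).
  apply: le_trans (cauchy_schwarz ipP _ _) _.
  have e'3 : e' * (2 * (norm v + 1)) <= norm (T v).
    by rewrite -ler_pdivlMr// /e' !ge_min lexx !orbT.
  apply: le_trans (ler_wpM2r (hnorm_ge0 ip v) yz') _; apply: le_trans e'3.
  rewrite mulrAC mulrA [leRHS]mulrC [e' * 2]mulrC.
  by nra.
have := ler_normB (rip (y - (z + realc d *: T (T v))) v +
                   (rip z v + d * norm (T v) ^+ 2))
                  (rip (y - (z + realc d *: T (T v))) v).
rewrite addrC addKr; move: big; rewrite -natr1 mulrDl mul1r; lra.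
Qed.

(** If the gap fails, the humps converge to some z, and z = T w as the range is closed. For each k
    some v with T v nonzero has k |T v| <= |<w, T v>| <= |w| |T v|, which is absurd for large k. *)
Lemma closed_range_gap : closed_range ip T ->
  exists2 c : R, 0 < c & forall v, c * norm (T v) <= norm (T (T v)).
Proof.
move=> Tcl; apply: contrapT => nogap.
have {}nogap c : 0 < c -> exists v, norm (T (T v)) < c * norm (T v).
  move=> c0; apply: contrapT => h; apply: nogap; exists c => // v.
  by rewrite leNgt; apply/negP => vlt; apply: h; exists v.
pose P (x : nat * (V * R)) (y : V * R) := range T x.2.1 -> 0 < x.2.2 ->
  [/\ range T y.1, [/\ 0 < y.2, y.2 <= x.2.2 / 2 & y.2 <= x.1.+1%:R^-1],
      norm (y.1 - x.2.1) <= x.2.2 &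
      exists2 v, 0 < norm (T v) & forall u,
        norm (u - y.1) <= 2 * y.2 -> x.1%:R * norm (T v) <= `|rip u v|].
have [[k [z e]]|F FP] := @choice _ _ P.
  have [[zT e0]|h] := pselect (range T z /\ 0 < e); last first.
    (* Default value where the premises of [P] fail. *)
    by exists (z, e) => /= zT e0; case: h.
  by have [z' [e' h]] := gliding_step k nogap zT e0; exists (z', e').
pose u := fix u n := if n is n'.+1 then F (n', u n') else (0 : V, 1 : R).
have uT n : range T (u n).1 /\ 0 < (u n).2.
  elim: n => [|n [IH1 IH2]]; first by split=> //; exists 0; rewrite ?linear_op0.
  by have [? [? _ _] _ _] := FP (n, u n) IH1 IH2.
have uP n := FP (n, u n) (uT n).1 (uT n).2.
(* The radii at least halve, so e_m <= 2 e_m - 2 e_(m+1) and the distances telescope. *)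
have u_le n j : norm ((u (n + j)%N).1 - (u n).1) <=
    2 * (u n).2 - 2 * (u (n + j)%N).2.
  elim: j => [|j IH]; first by rewrite addn0 !subrr hnorm0.
  rewrite addnS; have [_ [_ h _] h' _] := uP (n + j)%N.
  apply: le_trans (ler_hnorm_dist ipP _ (u (n + j)%N).1 _) _.
  by move: h h' IH => /=; lra.
have u_dist n m : (n <= m)%N -> norm ((u m).1 - (u n).1) <= 2 * (u n).2.
  move=> /subnKC <-; apply: le_trans (u_le _ _) _.
  by rewrite gerBl mulr_ge0// ltW// (uT _).2.
have [z zlim] : exists z, hconverges ip (fun n => (u n).1) z.
  apply: HV.2 => e e0.
  have e4 : 0 < 4 / e by rewrite divr_gt0.
  pose N := (Num.bound (4 / e)).+1; exists N => m n Nm Nn.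
  apply: le_lt_trans (ler_hnorm_dist ipP _ (u N).1 _) _.
  rewrite [X in _ + X](hnorm_distC ipP).
  have := u_dist _ _ Nm; have := u_dist _ _ Nn.
  have : (u N).2 <= N%:R^-1 by have [_ [_ _ h] _ _] := uP (Num.bound (4 / e)).
  have : N%:R^-1 < e / 4.
    rewrite -[ltRHS]invf_div ltf_pV2 ?posrE ?ltr0n//.
    by rewrite (lt_trans (archi_boundP (ltW e4)))// ltr_nat.
  by lra.
have zu n : norm (z - (u n).1) <= 2 * (u n).2.
  apply/ler_addgt0Pl => e e0; have [N NP] := zlim e e0.
  apply: le_trans (ler_hnorm_dist ipP _ (u (maxn N n)).1 _) _.
  by rewrite lerD ?u_dist ?leq_maxr// (hnorm_distC ipP) ltW// NP// leq_maxl.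
have [w _ wz] : range T z.
  apply: contrapT => /Tcl[e e0 he]; have [N NP] := zlim e e0.
  by apply: he (NP N (leqnn N)) (uT N).1.
have kw k : k%:R <= norm w.
  have [_ _ _ [v v0 /(_ z (zu k.+1))]] := uP k.
  rewrite -wz (adjoint_rip _ _ Tsa) => /le_trans/(_ (cauchy_schwarz ipP _ _)).
  by rewrite ler_pM2r.
have := archi_boundP (hnorm_ge0 ip w).
by rewrite ltNge kw.
Qed.

End ClosedRange.

(** * Approximate spectrum of a self-adjoint operator *)

Section ApproximateSpectrum.
Variables (R : realType) (V : lmodType R[i]) (ip : V -> V -> R[i]).
Hypothesis ipP : inner_product_axioms ip.
Implicit Types (S T : V -> V) (p q : {poly R[i]}).
Local Notation norm := (hnorm ip).
Local Notation rip := (re_ip ip).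
Local Notation realc := (real_complex R).

Definition bounded_below T :=
  exists2 c : R, 0 < c & forall v, c * norm v <= norm (T v).

Definition approx_spectrum T : set R[i] :=
  [set m | ~ bounded_below (pev ('X - m%:P) T)].

Lemma invertible_bounded_below T : invertible_op ip T -> bounded_below T.
Proof.
move=> [S Sb [ST _]]; have [M M0 SM] := bounded_bound Sb.
exists M^-1; rewrite ?invr_gt0// => v.
by rewrite ler_pdivrMl//; have := SM (T v); rewrite -[S (T v)]/((S \o T) v) ST.
Qed.

Lemma approx_spectrum_sub T : approx_spectrum T `<=` spectrum ip T.
Proof.
move=> m nbb /invertible_bounded_below bb; apply: nbb.
by case: bb => c c0 h; exists c => // v; rewrite pevXC.
Qed.

Lemma bounded_below_comp S T : bounded_below S -> bounded_below T ->
  bounded_below (S \o T).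
Proof.
move=> [c c0 Sc] [d d0 Td]; exists (c * d); rewrite ?mulr_gt0// => v.
by apply: le_trans (Sc _); rewrite -mulrA ler_pM2l.
Qed.

(** R[i] is algebraically closed, so q(T) is a scalar times a product of factors T - m; if all of
    these are bounded below, so is q(T). *)
Lemma not_bounded_below_root T q : linear T -> q != 0 ->
  ~ bounded_below (pev q T) -> exists2 m, root q m & approx_spectrum T m.
Proof.
move=> Tlin q0 nbb; apply: contrapT => h; apply: nbb.
have {}h m : root q m -> bounded_below (pev ('X - m%:P) T).
  by move=> qm; apply: contrapT => mT; apply: h; exists m.
have [rs qE] := closed_field_poly_normal q.
have lc0 : lead_coef q != 0 by rewrite lead_coef_eq0.
have {}h m : m \in rs -> bounded_below (pev ('X - m%:P) T).
  by move=> mrs; apply: h; rewrite qE rootZ// root_prod_XsubC.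
have [c c0 cP] : bounded_below (pev (\prod_(z <- rs) ('X - z%:P)) T).
  elim: rs h {qE} => [_|m rs IH h].
    by exists 1 => // v; rewrite big_nil pev1 mul1r.
  have [||c c0 cP] := @bounded_below_comp (pev ('X - m%:P) T)
      (pev (\prod_(z <- rs) ('X - z%:P)) T).
  - by apply: h; rewrite mem_head.
  - by apply: IH => z zrs; apply: h; rewrite inE zrs orbT.
  by exists c => // v; rewrite big_cons pevM.
have l0 : 0 < complex.Re `|lead_coef q|.
  rewrite normc_def/= sqrtr_gt0 lt_neqAle eq_sym addr_ge0 ?sqr_ge0// andbT.
  rewrite paddr_eq0 ?sqr_ge0// !sqrf_eq0; apply: contra lc0.
  by rewrite eq_complex.
exists (complex.Re `|lead_coef q| * c); rewrite ?mulr_gt0// => v.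
by rewrite [in pev q]qE pevZ hnormZ// -mulrA ler_pM2l.
Qed.

(* The witness k is the square of the operator norm of S. *)
Lemma self_adjoint_extremal S : bounded_op ip S -> self_adjoint ip S ->
  (exists v, S v <> 0) ->
  exists2 k : R, 0 < k & ~ bounded_below (fun v => S (S v) - realc k *: v).
Proof.
move=> Sb Ssa [v0 Sv0]; have [M M0 SM] := bounded_bound Sb.
pose E : set R := [set C | forall v, norm (S v) ^+ 2 <= C * norm v ^+ 2].
have normE v w : norm (v - w) ^+ 2 = norm v ^+ 2 - 2 * rip v w + norm w ^+ 2.
  rewrite !(hnorm_sqr ipP) !(ripDl ipP) !(ripDr ipP) !(ripNl ipP) !(ripNr ipP).
  by rewrite (ripC ipP w v); ring.
have Sv0_gt0 : 0 < norm (S v0).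
  rewrite lt_neqAle eq_sym hnorm_ge0 andbT.
  by apply/eqP => /(hnorm0_eq0 ipP).
have v0_gt0 : 0 < norm v0.
  rewrite lt_neqAle eq_sym hnorm_ge0 andbT; apply/eqP => v00.
  by move: (SM v0); rewrite v00 mulr0 leNgt Sv0_gt0.
have Elb C v : E C -> 0 < norm v -> norm (S v) ^+ 2 / norm v ^+ 2 <= C.
  by move=> EC v_gt0; rewrite ler_pdivrMr ?exprn_gt0.
have Einf : has_inf E.
  split; last by exists (norm (S v0) ^+ 2 / norm v0 ^+ 2) => C /Elb; exact.
  exists (M ^+ 2) => v; rewrite -exprMn ler_sqr ?nnegrE ?hnorm_ge0//.
  by rewrite mulr_ge0 ?hnorm_ge0 ?(ltW M0).
have k0 : 0 < inf E.
  apply: (@lt_le_trans _ _ (norm (S v0) ^+ 2 / norm v0 ^+ 2)).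
    by rewrite divr_gt0 ?exprn_gt0.
  by apply: lb_le_inf Einf.1 _ => C /Elb; exact.
have kE : E (inf E).
  move=> v; have [v_gt0|] := ltP 0 (norm v).
    rewrite -ler_pdivrMr ?exprn_gt0//.
    by apply: lb_le_inf Einf.1 _ => C /Elb; exact.
  move=> v_le0; have v00 : norm v = 0 by apply/le_anti; rewrite v_le0 hnorm_ge0.
  have Sv00 : norm (S v) = 0.
    by apply/le_anti; rewrite hnorm_ge0 andbT (le_trans (SM v))// v00 mulr0.
  by rewrite v00 Sv00 expr0n mulr0.
set k := inf E in k0 kE; exists k => // -[c c0 cP].
(* If |S S v - k v| >= c |v|, expanding the square and using |S S v|^2 <= k |S v|^2 gives |S v|^2 <=
   (k - c^2 / k) |v|^2, against the minimality of k. *)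
pose d := c ^+ 2 / k.
have d0 : 0 < d by rewrite divr_gt0// exprn_gt0.
suff : E (k - d).
  by move=> /(inf_lbound Einf.2); rewrite -/k lerBrDr gerDl leNgt d0.
move=> v; have := cP v.
rewrite -ler_sqr ?nnegrE ?hnorm_ge0 ?mulr_ge0 ?hnorm_ge0 ?(ltW c0)//.
rewrite normE hnormZr// (ripZr ipP) (adjoint_rip _ _ Ssa) -(hnorm_sqr ipP).
rewrite !exprMn real_normK ?num_real// => h1.
have h2 := kE (S v).
have kd : k * d = c ^+ 2 by rewrite mulrC divfK// gt_eqF.
rewrite -(ler_pM2l k0).
have -> : k * ((k - d) * norm v ^+ 2) = k ^+ 2 * norm v ^+ 2 - c ^+ 2 * norm v ^+ 2.
  by rewrite -kd; ring.
by lra.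
Qed.

Lemma map_poly_conjcK p : map_poly conjc (map_poly conjc p) = p.
Proof. by apply/polyP => i; rewrite !coef_map_id0 ?rmorph0//= conjcK. Qed.

Lemma self_adjoint_pev T p : linear T -> self_adjoint ip T ->
  map_poly conjc p = p -> self_adjoint ip (pev p T).
Proof.
move=> Tlin Tsa pE; rewrite /self_adjoint -[in X in is_adjoint _ _ X]pE.
exact: adjoint_pev.
Qed.

Lemma self_adjoint_algebraic T : bounded_op ip T -> self_adjoint ip T ->
  finite_set (approx_spectrum T) -> algebraic_op T.
Proof.
move=> Tb Tsa /finite_seqP[rs rsE]; have Tlin := bounded_linear Tb.
(* The extra root 0 serves to see that p^2 - k is not the zero polynomial, even when [rs] is empty:
   its value there is -k. The conjugate factor makes p real. *)
pose q := \prod_(z <- 0 :: rs) ('X - z%:P).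
pose p := q * map_poly conjc q.
have q_monic : q \is monic by rewrite monic_prod_XsubC.
have proot m : m \in 0 :: rs -> p.[m] = 0.
  by move=> mrs; apply/rootP; rewrite rootM root_prod_XsubC mrs.
have psa : self_adjoint ip (pev p T).
  by apply: self_adjoint_pev => //; rewrite rmorphM/= map_poly_conjcK mulrC.
exists p; first by rewrite mulf_neq0 ?map_poly_eq0 ?monic_neq0.
move=> v; apply: contrapT => pv0.
have [|k k0 kP] := self_adjoint_extremal (bounded_pev ipP p Tb) psa.
  by exists v.
have [||m] := @not_bounded_below_root T (p * p - (realc k)%:P) Tlin.
- apply/negP => /eqP/(congr1 (fun r => r.[0])); rewrite hornerD hornerN hornerM.
  rewrite proot ?mem_head// mul0r hornerC horner0 add0r => /eqP.
  by rewrite oppr_eq0 (inj_eq (@complexI R)) gt_eqF.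
- move=> [c c0 cP]; apply: kP; exists c => // u.
  by have := cP u; rewrite pevB pevM// pevC.
rewrite /root hornerD hornerN hornerM hornerC => mroot.
rewrite rsE => mrs; move: mroot; rewrite proot ?inE ?[m \in rs]mrs ?orbT//.
by rewrite mul0r add0r oppr_eq0 (inj_eq (@complexI R)) gt_eqF.
Qed.

Lemma approx_spectrum_real T m : self_adjoint ip T -> approx_spectrum T m ->
  m = realc (complex.Re m).
Proof.
move=> Tsa nbb; apply/eqP; rewrite eq_complex eqxx/=.
apply: contrapT => /negP m0; apply: nbb.
exists `|complex.Im m|; first by rewrite normr_gt0.
move=> v; rewrite pevXC.
have [v0|v0] := eqVneq (norm v) 0; first by rewrite v0 mulr0 hnorm_ge0.
have v_gt0 : 0 < norm v by rewrite lt_neqAle eq_sym v0 hnorm_ge0.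
have ipT : complex.Im (ip (T v) v) = 0.
  have := ip_conj ipP (T v) v; rewrite -(Tsa v v).
  case: (ip (T v) v) => a b /= [] /eqP.
  by rewrite -subr_eq0 opprK -mulr2n mulrn_eq0 => /eqP.
have ni x : norm ('i%C *: x) = norm x.
  by rewrite hnormZ// normc_def/= expr0n expr1n add0r sqrtr1 mul1r.
(* As <T v, v> is real, the real part of <i (T v - m v), v> has modulus |Im m| |v|^2. *)
have := cauchy_schwarz ipP ('i%C *: (T v - m *: v)) v; rewrite ni.
rewrite /re_ip ipZl// ipDl// -scaleNr ipZl//.
rewrite (ip_rip ipP v) -(hnorm_sqr ipP); move: ipT.
case: (ip (T v) v) => a b /= ->; case: m m0 => mr mi /= _.
rewrite !(mul0r, mulr0, mul1r, add0r, addr0, oppr0, subr0, sub0r, opprK).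
rewrite mulNr opprK normrM (ger0_norm (sqr_ge0 _)) expr2 mulrA.
by rewrite ler_pM2r.
Qed.

Lemma approx_spectrum_bound T M (r : R) :
  (forall v, norm (T v) <= M * norm v) -> approx_spectrum T (realc r) ->
  `|r| <= M.
Proof.
move=> TM nbb; rewrite leNgt; apply/negP => Mr; apply: nbb.
exists (`|r| - M); first by rewrite subr_gt0.
move=> v; rewrite pevXC hnorm_distC//.
by have := ler_hnormBr ipP (realc r *: v) (T v); have := TM v; rewrite hnormZr//; lra.
Qed.

(** Put S = p(T). The gap bounds S - h from below on the range of S, and h v = S v - (S v - h v)
    extends this to all v. As 'X - m divides p - h, the bound passes to T - m. *)
Lemma gap_bounded_below T p (m : R[i]) (c h : R) : bounded_op ip T ->
  (forall v, c * norm (pev p T v) <= norm (pev p T (pev p T v))) ->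
  p.[m] = realc h -> 0 < `|h| < c -> bounded_below (pev ('X - m%:P) T).
Proof.
move=> Tb gap pm /andP[h0 hc]; have Tlin := bounded_linear Tb.
have /factor_theorem[g gE] : root (p - p.[m]%:P) m.
  by rewrite /root hornerD hornerN hornerC subrr.
have [N N0 SN] := bounded_bound (bounded_pev ipP p Tb).
have [K K0 gK] := bounded_bound (bounded_pev ipP g Tb).
have ch : 0 < c - `|h| by rewrite subr_gt0.
have D0 : 0 < (N + (c - `|h|)) * K by rewrite mulr_gt0// addr_gt0.
exists ((c - `|h|) * `|h| / ((N + (c - `|h|)) * K)).
  by rewrite divr_gt0// mulr_gt0.
move=> v; set u := pev _ T v; set s := pev p T v.
pose w := s - realc h *: v.
have wE : w = pev g T u.
  by rewrite /w /s /u -pevM// -gE pevB pevC pm.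
have wK : norm w <= K * norm u by rewrite wE.
have h1 : (c - `|h|) * norm s <= N * norm w.
  apply: le_trans (SN w).
  have -> : pev p T w = pev p T s - realc h *: s.
    by rewrite /w (linear_opB (pev_linear p Tlin)) (linear_opZ (pev_linear p Tlin)).
  have := ler_hnormBr ipP (pev p T s) (realc h *: s).
  by have := gap v; rewrite hnormZr// -/s; lra.
have h2 : `|h| * norm v <= norm s + norm w.
  rewrite -hnormZr//; have -> : realc h *: v = s - w by rewrite /w opprB addrC subrK.
  by rewrite -(hnormN ipP w) ler_hnormD.
rewrite mulrAC ler_pdivrMr//.
have h3 : (c - `|h|) * (`|h| * norm v) <= (c - `|h|) * (norm s + norm w).
  by rewrite ler_pM2l.
have h4 : (N + (c - `|h|)) * norm w <= (N + (c - `|h|)) * (K * norm u).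
  by rewrite ler_pM2l// addr_gt0.
by lra.
Qed.

(** Let D be the set of t below which E is finite. If E were infinite, D would be bounded, but local
    finiteness at sup D pushes D beyond it. *)
Lemma finite_locally_finite_bounded (E : set R) (M : R) :
  (forall x, E x -> `|x| <= M) ->
  (forall x, exists2 e, 0 < e & finite_set [set y | E y /\ `|y - x| < e]) ->
  finite_set E.
Proof.
move=> EM Eloc; pose D : set R := [set t | finite_set [set y | E y /\ y <= t]].
have DM t : M <= t -> D t -> finite_set E.
  move=> Mt; apply: sub_finite_set => y Ey; split=> //.
  by rewrite (le_trans (ler_norm _))// (le_trans (EM _ Ey)).
have D0 : D (- M - 1).
  apply: sub_finite_set (finite_set0 _) => y [/EM yM].
  by have := ler_norm (- y); rewrite normrN /=; lra.
apply: contrapT => Einf.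
have Dsup : has_sup D.
  split; first by exists (- M - 1).
  exists M => t Dt; rewrite leNgt; apply/negP => /ltW Mt.
  exact/Einf/(DM t).
have [e e0 Ee] := Eloc (sup D).
have [t Dt te] := sup_adherent e0 Dsup.
suff /(sup_upper_bound Dsup) : D (sup D + e / 2).
  by rewrite gerDl leNgt divr_gt0.
have : finite_set ([set y | E y /\ y <= t] `|` [set y | E y /\ `|y - sup D| < e]).
  by rewrite finite_setU.
apply: sub_finite_set => y [Ey ys] /=.
have [yt|ty] := leP y t; [by left|right; split=> //].
by rewrite ltr_distl; apply/andP; split; lra.
Qed.

End ApproximateSpectrum.

(** * The subalgebra generated by one operator *)

Section GeneratedSubalgebra.
Variables (R : realType) (V : lmodType R[i]) (T : V -> V).

Lemma gen_subalgebraP (S : V -> V) :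
  gen_subalgebra T S <-> exists p, S = pev (p * 'X) T.
Proof.
split=> [[n [c ->]]|[p ->]].
  exists (rVpoly (\row_i c i)); apply/funext => v.
  rewrite pevMX (@pev_wide _ _ n) ?size_poly//; apply: eq_bigr => i _.
  by rewrite coef_rVpoly_ord mxE -iterSr.
exists (size p), (fun i : 'I_(size p) => p`_i); apply/funext => v.
by rewrite pevMX; apply: eq_bigr => i _; rewrite -iterSr.
Qed.

Lemma algebraic_finite_dim : linear T -> algebraic_op T ->
  finite_dim (gen_subalgebra T).
Proof.
move=> Tlin Talg; have [n nP] := algebraic_gen_span Tlin Talg.
exists n, (fun i : 'I_n => iter i.+1 T); split=> [i|S /gen_subalgebraP[p ->]].
  apply/gen_subalgebraP; exists 'X^i; apply/funext => v.
  by rewrite pevMX pevXn// -iterSr.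
by have [c cP] := nP p; exists c; apply/funext => v; exact: cP.
Qed.

(** The n + 1 powers T, ..., T^(n+1) lie in the span of n operators; a left kernel vector of their
    coefficient matrix, shifted by 'X, is an annihilating polynomial. *)
Lemma finite_dim_algebraic : linear T -> finite_dim (gen_subalgebra T) ->
  algebraic_op T.
Proof.
move=> Tlin [n [b [_ Wb]]].
have [i|C CE] := @choice 'I_n.+1 ('I_n -> R[i])
    (fun i c => iter i.+1 T = (fun v => \sum_(j < n) c j *: b j v)).
  apply: Wb; apply/gen_subalgebraP; exists 'X^i; apply/funext => v.
  by rewrite pevMX pevXn// -iterSr.
pose M := \matrix_(i < n.+1, j < n) C i j.
have /rowV0Pn[u /sub_kermxP uM u0] : kermx M != 0.
  by rewrite -mxrank_eq0 mxrank_ker -lt0n subn_gt0 ltnS rank_leq_col.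
exists (rVpoly u * 'X).
  rewrite mulf_neq0 ?polyX_eq0//; apply: contraNneq u0 => u0.
  by rewrite -[u]rVpolyK u0 linear0.
move=> v; rewrite pevMX (@pev_wide _ _ n.+1) ?size_poly//.
transitivity (\sum_(j < n) (u *m M) 0 j *: b j v); last first.
  by rewrite uM big1// => j _; rewrite mxE scale0r.
under [RHS]eq_bigr => j _ do rewrite mxE scaler_suml.
rewrite exchange_big; apply: eq_bigr => i _.
rewrite coef_rVpoly_ord -iterSr CE scaler_sumr.
by apply: eq_bigr => j _; rewrite scalerA mxE.
Qed.

End GeneratedSubalgebra.

(** A countable union of finite sets is countable, while [0, 1] has Lebesgue measure 1. *)
Lemma cover_infinite (R : realType) (E : nat -> set R) :
  \bigcup_n E n = setT -> exists n, infinite_set (E n).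
Proof.
move=> ET; apply: contrapT => /forallNP Efin.
have cT : countable [set: R].
  rewrite -ET; apply: bigcup_countable => // n _; apply: finite_set_countable.
  by apply: contrapT; exact: Efin.
have := sub_countable (subset_card_le (@subsetT _ `[0%R, 1%R]%classic)) cT.
move=> /(@countable_lebesgue_measure0 R).
rewrite lebesgue_measure_itv/= lte_fin ltr01 oppr0 adde0 => /eqP.
by rewrite onee_eq0.
Qed.

(** * Star-subalgebras: regularity, closed ranges, algebraicity *)

Section StarSubalgebra.
Variables (R : realType) (V : lmodType R[i]) (ip : V -> V -> R[i]).
Hypothesis HV : hilbert_space ip.
Let ipP : inner_product_axioms ip := HV.1.
Variable A : set (V -> V).
Hypothesis HA : star_subalgebra ip A.
Local Notation norm := (hnorm ip).
Local Notation rip := (re_ip ip).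
Local Notation realc := (real_complex R).

Lemma star_bounded T : A T -> bounded_op ip T.
Proof. by case: HA => + _; apply. Qed.

Lemma star_linear T : A T -> linear T.
Proof. by move=> /star_bounded []. Qed.

Lemma star_add S T : A S -> A T -> A (fun x => S x + T x).
Proof. by case: HA => _ [_ [+ _]]; apply. Qed.

Lemma star_scale a T : A T -> A (fun x => a *: T x).
Proof. by case: HA => _ [_ [_ [+ _]]]; apply. Qed.

Lemma star_comp S T : A S -> A T -> A (S \o T).
Proof. by case: HA => _ [_ [_ [_ [+ _]]]]; apply. Qed.

Lemma star_adjoint T : A T -> exists2 S, A S & is_adjoint ip T S.
Proof. by case: HA => _ [_ [_ [_ [_ +]]]]; apply. Qed.

(** The factor 'X removes the constant term, since the identity need not lie in A. *)
Lemma star_pevMX T p : A T -> A (pev (p * 'X) T).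
Proof.
move=> AT; elim/poly_ind: p => [|p c IH].
  suff -> : pev (0 * 'X) T = fun=> 0 by case: HA => _ [].
  by apply/funext => v; rewrite mul0r pev0.
suff -> : pev ((p * 'X + c%:P) * 'X) T =
    (fun v => (pev (p * 'X) T \o T) v + c *: T v).
  by apply: star_add; [exact: star_comp|exact: star_scale].
by apply/funext => v; rewrite !pevMX pevD pevC.
Qed.

(** The bounded operator 1 - x y vanishes exactly on the range of x. Its value w at a point z
    outside the range is nonzero, so it stays nonzero near z. *)
Lemma regular_closed_range x y : bounded_op ip x -> bounded_op ip y ->
  x \o y \o x = x -> closed_range ip x.
Proof.
move=> xb yb xyx z zx; have xyb := bounded_comp xb yb.
have [M M0 xyM] := bounded_bound xyb.
pose w := z - x (y z).
have w0 : 0 < norm w.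
  rewrite lt_neqAle eq_sym hnorm_ge0 andbT; apply/eqP => /(hnorm0_eq0 ipP).
  by move=> /eqP; rewrite subr_eq0 => /eqP zE; apply: zx; exists (y z).
have M1 : 0 < M + 1 by rewrite addr_gt0.
exists (norm w / (M + 1)); first by rewrite divr_gt0.
move=> _ /[swap] -[u _ <-].
have xyxu : x (y (x u)) = x u by rewrite -[in RHS]xyx.
have -> : norm w = norm ((x u - z) - x (y (x u - z))).
  have -> : x (y (x u - z)) = x u - x (y z).
    by have := linear_opB xyb.1 (x u) z; rewrite /= xyxu.
  by rewrite /w -hnormN// !opprB [in RHS]addrC addrA subrK.
rewrite ltr_pdivlMr// ltNge => /negP; apply.
have := ler_hnormD ipP (x u - z) (- x (y (x u - z))).
by rewrite hnormN//; have := xyM (x u - z); rewrite /=; lra.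
Qed.

(** Let p(a) a = 0 with p = r 'X + c. If c is nonzero, q = -r / c works; if c = 0, one factor a
    cancels because self-adjointness gives ker a^2 = ker a. *)
Lemma self_adjoint_algebraic_inverse a : linear a -> self_adjoint ip a ->
  algebraic_op a -> exists q, forall v, a (pev q a (a v)) = a v.
Proof.
move=> alin asa [p p0 pa]; have {pa} : forall v, pev p a (a v) = 0 by [].
elim/poly_ind: p p0 => [|p c IH]; first by rewrite eqxx.
have [->|c0 _ pa] := eqVneq c 0; last first.
  exists (- c^-1 *: p) => v; rewrite pevZ (linear_opZ alin) (pev_comm alin).
  have := pa v; rewrite pevD pevMX pevC => /eqP; rewrite addr_eq0 => /eqP ->.
  by rewrite scaleNr scalerN opprK scalerA mulVf// scale1r.
rewrite addr0 => pX pa; apply: IH => [|v].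
  by apply: contraNneq pX => ->; rewrite mul0r.
rewrite -(pev_comm alin); apply: (hnorm0_eq0 ipP); apply/eqP; rewrite -sqrf_eq0.
rewrite (hnorm_sqr ipP) (adjoint_rip _ _ asa) 2!(pev_comm alin) -pevMX pa.
by rewrite ripC// /re_ip (form0 (ip_lin ipP)).
Qed.

Lemma algebraic_regular : (forall T, A T -> self_adjoint ip T -> algebraic_op T) ->
  forall x, A x -> exists2 y, A y & x \o y \o x = x.
Proof.
move=> Aalg x Ax; have [s As xs] := star_adjoint Ax.
pose a := s \o x; have Aa : A a by exact: star_comp.
have sx : is_adjoint ip s x by move=> u v; rewrite ip_conj// -xs -ip_conj.
have asa : self_adjoint ip a by move=> u v; rewrite /a/= sx xs.
have alin := star_linear Aa.
have [q qP] := self_adjoint_algebraic_inverse alin asa (Aalg _ Aa asa).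
(* The factor 'X places z in A whatever the constant term of q, and a z a = a still holds. *)
pose z := pev (q * q * 'X) a.
exists (z \o s); first by apply: star_comp => //; exact: star_pevMX.
apply/funext => v /=; rewrite -[s (x v)]/(a v).
have aza : a (z (a v)) = a v.
  by rewrite /z pevMX pevM// -[pev q a (a (a v))](pev_comm alin) qP qP.
have az0 : a (z (a v) - v) = 0 by rewrite linear_opB// aza subrr.
(* The kernels of x and a agree, since |x u|^2 = <u, a u>. *)
apply/eqP; rewrite -subr_eq0 -(linear_opB (star_linear Ax)); apply/eqP.
apply: (hnorm0_eq0 ipP); apply/eqP; rewrite -sqrf_eq0 (hnorm_sqr ipP).
rewrite (adjoint_rip _ _ xs) -[s (x _)]/(a _) az0.
by rewrite ripC// /re_ip (form0 (ip_lin ipP)).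
Qed.

Lemma closed_range_approx_spectrum T :
  (forall S, A S -> self_adjoint ip S -> closed_range ip S) ->
  A T -> self_adjoint ip T -> finite_set (approx_spectrum ip T).
Proof.
move=> Acl AT Tsa; have Tb := star_bounded AT; have Tlin := star_linear AT.
have [M M0 TM] := bounded_bound Tb.
pose E : set R := [set r | approx_spectrum ip T (realc r)].
suff : finite_set E.
  move=> /(finite_image realc); apply: sub_finite_set => m mT.
  have mE := approx_spectrum_real ipP Tsa mT.
  exists (complex.Re m); last exact: esym.
  by rewrite mE in mT.
have EM r : E r -> `|r| <= M by exact: approx_spectrum_bound.
apply: (finite_locally_finite_bounded EM) => x0.
(* The factor 'X keeps p(T) in A; the other makes p(y) = (y - x0) y small near x0. *)
pose p : {poly R[i]} := ('X - (realc x0)%:P) * 'X.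
have psa : self_adjoint ip (pev p T).
  apply: self_adjoint_pev => //.
  by rewrite rmorphM rmorphB/= map_polyX map_polyC/= oppr0.
have pb := bounded_pev ipP p Tb.
have [c c0 gap] := closed_range_gap HV pb psa (Acl _ (star_pevMX _ AT) psa).
(* As |y| <= M on E, this radius forces |p(y)| < c, so y in E survives only where p(y) = 0. *)
exists (c / M); first by rewrite divr_gt0.
apply: sub_finite_set (finite_set2 x0 0) => y [Ey yx0].
have [|y0] := eqVneq ((y - x0) * y) 0.
  by move=> /eqP; rewrite mulf_eq0 subr_eq0 => /orP[]/eqP->; [left|right].
have yM := EM _ Ey; exfalso; apply: Ey.
apply: (gap_bounded_below (h := (y - x0) * y) ipP Tb gap).
  by rewrite hornerM hornerXsubC hornerX rmorphM rmorphB.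
rewrite normr_gt0 y0 normrM /=; apply: (@le_lt_trans _ _ (`|y - x0| * M)).
  by rewrite ler_wpM2l.
by rewrite -ltr_pdivlMr.
Qed.

(* The self-adjoint elements h(1/2) + t h(-i/2), t real, are algebraic of some
   common degree for infinitely many t, hence so is x, which is the case t = i. *)
Lemma algebraic_of_self_adjoint :
  (forall T, A T -> self_adjoint ip T -> algebraic_op T) ->
  forall x, A x -> algebraic_op x.
Proof.
move=> Aalg x Ax; have [s As xs] := star_adjoint Ax.
have sx : is_adjoint ip s x by move=> u v; rewrite ip_conj// -xs -ip_conj.
pose h (c : R[i]) v := c *: x v + conjc c *: s v.
have Ah c : A (h c) by apply: star_add; exact: star_scale.
have hsa c : self_adjoint ip (h c).
  move=> u v; rewrite /h (ipDl ipP) !(ipZl ipP) xs sx [RHS](ip_conj ipP)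
    (ipDl ipP) !(ipZl ipP).
  by rewrite rmorphD !rmorphM/= conjcK -!(ip_conj ipP) addrC.
(* [h c1] and [h c2] are the real and imaginary parts of x. As h is only real-linear in c, t is real
   until the pencil is evaluated at i. *)
pose c1 : R[i] := realc 2^-1; pose c2 : R[i] := - ('i%C * realc 2^-1).
have hE (t : R) : (fun v => h c1 v + realc t *: h c2 v) = h (c1 + realc t * c2).
  have -> : h (c1 + realc t * c2) = fun v => (c1 + realc t * c2) *: x v +
      (conjc c1 + realc t * conjc c2) *: s v.
    apply/funext => v; rewrite /h rmorphD rmorphM; congr (_ + (_ + _ * _) *: _).
    exact: conjc_real.
  by apply/funext => v; rewrite /h scalerDr !scalerA !scalerDl addrACA.
pose E d : set R := [set t | exists2 p : {poly R[i]}, p != 0 /\ (size p <= d)%N &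
  forall v, pev p (fun v => h c1 v + realc t *: h c2 v) v = 0].
have [d Ed] : exists d, infinite_set (E d).
  apply: cover_infinite; rewrite -subTset => t _.
  have [p p0 pt] := Aalg _ (Ah (c1 + realc t * c2)) (hsa _).
  by exists (size p) => //; exists p => // v; rewrite hE.
have Einf : infinite_set (realc @` E d).
  move=> /(finite_image (@complex.Re R)) Efin; apply: Ed.
  by apply: sub_finite_set Efin => t Et; exists (realc t) => //; exists t.
have [|p p0 px] := algebraic_pencil (ip_lin ipP) (ip_def ipP) (star_linear (Ah c1))
    (star_linear (Ah c2)) (d := d) 'i%C Einf.
  by move=> _ [t [p [p0 pd] pt] <-]; exists p.
exists p => // v; rewrite -[RHS](px v); congr (pev p _ v); apply/funext => u.
have e1 : c1 + 'i%C * c2 = 1.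
  by apply/eqP; rewrite eq_complex /=; apply/andP; split; apply/eqP; field.
have e2 : conjc c1 + 'i%C * conjc c2 = 0.
  by apply/eqP; rewrite eq_complex /=; apply/andP; split; apply/eqP; field.
by rewrite /h scalerDr !scalerA addrACA -!scalerDl e1 e2 scale1r scale0r addr0.
Qed.

(** If p(m) is nonzero, p - p(m) = g ('X - m) gives g(T) (T - m) = -p(m), which inverts T - m. *)
Lemma algebraic_finite_spectrum T : bounded_op ip T -> algebraic_op T ->
  finite_set (spectrum ip T).
Proof.
move=> Tb [p p0 pT]; have Tlin := bounded_linear Tb.
apply: sub_finite_set (finite_set_roots p0) => m mT /=.
apply/eqP; apply: contrapT => /eqP pm; apply: mT.
have /factor_theorem[g gE] : root (p - p.[m]%:P) m.
  by rewrite /root hornerD hornerN hornerC subrr.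
have inv v : pev (p - p.[m]%:P) T v = - p.[m] *: v.
  by rewrite pevB pevC pT add0r scaleNr.
exists (fun v => (- p.[m]^-1) *: pev g T v).
  exact: bounded_scale (bounded_pev ipP g Tb).
split; apply/funext => v /=; rewrite -?pevXC.
  by rewrite -pevM// -gE inv scalerA mulrNN mulVf// scale1r.
rewrite (linear_opZ (pev_linear _ Tlin)) -pevM// mulrC -gE inv scalerA.
by rewrite mulrNN mulVf// scale1r.
Qed.

End StarSubalgebra.

(** * The cycle of implications between the six conditions *)

Theorem theorem2p1 (R : realType) (V : lmodType R[i]) (ip : V -> V -> R[i])
  (HV : hilbert_space ip) (A : set (V -> V)) (HA : star_subalgebra ip A) :
  [<->
    (* (1) von Neumann regular *)
    (forall x, A x -> exists2 y, A y & x \o y \o x = x);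
    (* (2) algebraic *)
    (forall x, A x -> finite_dim (gen_subalgebra x));
    (* (3) closed ranges *)
    (forall x, A x -> closed_range ip x);
    (* (4) finite spectra *)
    (forall x, A x -> finite_set (spectrum ip x));
    (* (5) self-adjoint elements have closed range *)
    (forall x, A x -> self_adjoint ip x -> closed_range ip x);
    (* (6) self-adjoint elements have finite spectrum *)
    (forall x, A x -> self_adjoint ip x -> finite_set (spectrum ip x))].
Proof.
have ipP := HV.1.
have Ab := star_bounded HA; have Al := star_linear HA.
have sa_alg : (forall x, A x -> self_adjoint ip x -> finite_set (spectrum ip x)) ->
    forall x, A x -> self_adjoint ip x -> algebraic_op x.
  move=> Afin x Ax xsa; apply: (self_adjoint_algebraic ipP (Ab _ Ax) xsa).
  exact: sub_finite_set (approx_spectrum_sub (T := x)) (Afin _ Ax xsa).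
have h13 : (forall x, A x -> exists2 y, A y & x \o y \o x = x) ->
    forall x, A x -> closed_range ip x.
  move=> Areg x Ax; have [y Ay xyx] := Areg x Ax.
  exact (regular_closed_range HV (Ab _ Ax) (Ab _ Ay) xyx).
have h56 : (forall x, A x -> self_adjoint ip x -> closed_range ip x) ->
    forall x, A x -> self_adjoint ip x -> finite_set (spectrum ip x).
  move=> Acl x Ax xsa; apply: (algebraic_finite_spectrum HV (Ab _ Ax)).
  apply: (self_adjoint_algebraic ipP (Ab _ Ax) xsa).
  exact (closed_range_approx_spectrum HV HA Acl Ax xsa).
have h61 : (forall x, A x -> self_adjoint ip x -> finite_set (spectrum ip x)) ->
    forall x, A x -> exists2 y, A y & x \o y \o x = x.
  by move=> Afin; exact (algebraic_regular HV HA (sa_alg Afin)).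
have h62 : (forall x, A x -> self_adjoint ip x -> finite_set (spectrum ip x)) ->
    forall x, A x -> finite_dim (gen_subalgebra x).
  move=> /sa_alg/(algebraic_of_self_adjoint HV HA) Aalg x Ax.
  by apply: algebraic_finite_dim; [exact: Al|exact: Aalg].
have h24 : (forall x, A x -> finite_dim (gen_subalgebra x)) ->
    forall x, A x -> finite_set (spectrum ip x).
  move=> Afd x Ax; apply: (algebraic_finite_spectrum HV (Ab _ Ax)).
  exact: finite_dim_algebraic (Al _ Ax) (Afd _ Ax).
(* The links run through (6), where self-adjoint elements are algebraic: for instance (1) => (3) =>
   (5) => (6) => (2). *)
tfae.
- by move=> /h13 Acl; apply/h62/h56 => x Ax _; exact: Acl.
- by move=> /h24 Afin; apply/h13/h61 => x Ax _; exact: Afin.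
- by move=> Acl; apply/h24/h62/h56 => x Ax _; exact: Acl.
- move=> Afin x Ax _; move: x Ax; apply/h13/h61 => x Ax _; exact: Afin.
- exact: h56.
- exact: h61.
Qed.
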